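(* Let $F_n$ be the free group of finite rank $n$. The tensor square $F_n\otimes F_n$ has a faithful representation into $GL_2(\mathbb{Z}[t_1^{\pm1},\ldots,t_m^{\pm1}])$, where $m=\frac{n(n+1)}{2}$.
   Context: With $x^y=y^{-1}xy$, the non-abelian tensor square $G\otimes G$ of a group $G$ is the group generated by the symbols $g\otimes h$ ($g,h\in G$) subject to the relations $gg_1\otimes h=(g^{g_1}\otimes h^{g_1})(g_1\otimes h)$ and $g\otimes hh_1=(g\otimes h_1)(g^{h_1}\otimes h^{h_1})$ for all $g,g_1,h,h_1\in G$. $\mathbb{Z}[t_1^{\pm1},\ldots,t_m^{\pm1}]$ is the Laurent polynomial ring in $m$ variables. A faithful representation is an injective homomorphism. *)

(* Defs.v *)
From HB Require Import structures.
From mathcomp Require Import all_boot all_fingroup all_algebra.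
From mathcomp Require Import generic_quotient fraction boolp mpoly.

Set Implicit Arguments.
Unset Strict Implicit.
Unset Printing Implicit Defensive.

Import GRing.Theory.
Local Open Scope quotient_scope.

(* A letter (x, false) stands for the generator x, and (x, true) for its      *)
(* inverse; a word stands for the product of its letters from left to right.  *)
Notation word X := (seq (X * bool)).

Definition gen_word (X : Type) (x : X) : word X := [:: (x, false)].

Definition inv_word (X : Type) (w : word X) : word X :=
  rev [seq (l.1, ~~ l.2) | l <- w].

Section Presentation.
Variables (X : choiceType) (rel_ : word X -> word X -> Prop).

(* r = s is imposed for all r, s such that rel_ r s.                          *)
Inductive pres_eq : word X -> word X -> Prop :=
| PresRel u v r s : rel_ r s -> pres_eq (u ++ r ++ v) (u ++ s ++ v)
| PresCancel u v x b : pres_eq (u ++ (x, b) :: (x, ~~ b) :: v) (u ++ v)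
| PresRefl w : pres_eq w w
| PresSym w1 w2 : pres_eq w1 w2 -> pres_eq w2 w1
| PresTrans w1 w2 w3 : pres_eq w1 w2 -> pres_eq w2 w3 -> pres_eq w1 w3.

Lemma pres_eq_ctx u v w1 w2 :
  pres_eq w1 w2 -> pres_eq (u ++ w1 ++ v) (u ++ w2 ++ v).
Proof.
elim=> [u' v' r s rs|u' v' x b|w|w w' _|w w' w'' _ h _]; last 1 first.
- exact: PresTrans.
- by have := PresRel (u ++ u') (v' ++ v) rs; rewrite -!catA.
- by have := PresCancel (u ++ u') (v' ++ v) x b; rewrite -!catA.
- exact: PresRefl.
- exact: PresSym.
Qed.

Lemma pres_eq_cat u1 u2 v1 v2 :
  pres_eq u1 u2 -> pres_eq v1 v2 -> pres_eq (u1 ++ v1) (u2 ++ v2).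
Proof.
move=> /(pres_eq_ctx [::] v1) h1 /(pres_eq_ctx u2 [::]).
by rewrite !cats0; apply: PresTrans.
Qed.

Lemma inv_wordK : involutive (@inv_word X).
Proof.
move=> w; rewrite /inv_word map_rev revK -map_comp map_id_in // => -[x b] _ /=.
by rewrite negbK.
Qed.

Lemma pres_mulVw w : pres_eq (inv_word w ++ w) [::].
Proof.
elim: w => [|[x b] w ih]; first exact: PresRefl.
rewrite /inv_word /= rev_cons cat_rcons.
apply: PresTrans ih; rewrite -[X in pres_eq (_ ++ _ :: (x, X) :: _)]negbK.
exact: PresCancel.
Qed.

Lemma pres_mulwV w : pres_eq (w ++ inv_word w) [::].
Proof. by rewrite -{1}(inv_wordK w); apply: pres_mulVw. Qed.

Lemma pres_eq_inv w1 w2 : pres_eq w1 w2 -> pres_eq (inv_word w1) (inv_word w2).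
Proof.
move=> h.
apply: (@PresTrans _ (inv_word w1 ++ w2 ++ inv_word w2)).
  apply: PresSym; rewrite -[X in pres_eq _ X]cats0.
  by apply: pres_eq_cat (PresRefl _) _; apply: pres_mulwV.
rewrite catA -[X in pres_eq _ X]cat0s.
apply: pres_eq_cat (PresRefl _).
apply: PresTrans (pres_mulVw w1).
by apply: pres_eq_cat (PresRefl _) (PresSym h).
Qed.

Definition pres_eqb (w1 w2 : word X) : bool := `[< pres_eq w1 w2 >].

Lemma pres_eqb_refl : reflexive pres_eqb.
Proof. by move=> w; apply/asboolP/PresRefl. Qed.

Lemma pres_eqb_sym : ssrbool.symmetric pres_eqb.
Proof. by move=> w1 w2; apply: asbool_equiv_eq; split; apply: PresSym. Qed.

Lemma pres_eqb_trans : transitive pres_eqb.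
Proof.
by move=> w2 w1 w3 /asboolP h12 /asboolP h23; apply/asboolP/PresTrans/h23.
Qed.

Definition pres_equiv := EquivRel pres_eqb pres_eqb_refl pres_eqb_sym
  pres_eqb_trans.

Definition presented := {eq_quot pres_equiv}.
HB.instance Definition _ := EqQuotient.on presented.
HB.instance Definition _ := Choice.on presented.

Local Open Scope quotient_scope.

Definition pres_class (w : word X) : presented := \pi w.

Lemma pres_classP w1 w2 : pres_class w1 = pres_class w2 <-> pres_eq w1 w2.
Proof.
by split=> [/eqmodP/asboolP//|h]; apply/eqmodP/asboolP.
Qed.

Lemma pres_reprK (a : presented) : pres_class (repr a) = a.
Proof. exact: reprK. Qed.

Definition pres_one : presented := pres_class [::].
Definition pres_inv (a : presented) := pres_class (inv_word (repr a)).
Definition pres_mul (a b : presented) := pres_class (repr a ++ repr b).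

Lemma pres_mulE w1 w2 :
  pres_mul (pres_class w1) (pres_class w2) = pres_class (w1 ++ w2).
Proof. by apply/pres_classP/pres_eq_cat; apply/pres_classP/pres_reprK. Qed.

Lemma pres_invE w : pres_inv (pres_class w) = pres_class (inv_word w).
Proof. by apply/pres_classP/pres_eq_inv; apply/pres_classP/pres_reprK. Qed.

Fact pres_mulA : associative pres_mul.
Proof.
move=> a b c; rewrite -(pres_reprK a) -(pres_reprK b) -(pres_reprK c).
by rewrite !pres_mulE catA.
Qed.

Fact pres_mul1 : left_id pres_one pres_mul.
Proof. by move=> a; rewrite -(pres_reprK a) pres_mulE. Qed.

Fact pres_mulr1 : right_id pres_one pres_mul.
Proof. by move=> a; rewrite -(pres_reprK a) pres_mulE cats0. Qed.

Fact pres_mulV : left_inverse pres_one pres_inv pres_mul.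
Proof.
move=> a; rewrite -(pres_reprK a) pres_invE pres_mulE.
exact/pres_classP/pres_mulVw.
Qed.

Fact pres_mulrV : right_inverse pres_one pres_inv pres_mul.
Proof.
move=> a; rewrite -(pres_reprK a) pres_invE pres_mulE.
exact/pres_classP/pres_mulwV.
Qed.

HB.instance Definition _ := isGroup.Build presented
  pres_mulA pres_mul1 pres_mulr1 pres_mulV pres_mulrV.

End Presentation.

Definition free_group (n : nat) : groupType :=
  presented (fun _ _ : word 'I_n => False).

Section TensorSquare.
Variable G : groupType.
Local Open Scope group_scope.
Local Notation "g ⊗ h" := (gen_word (g, h)) (at level 45).

(* The library's conjugation is x ^ y = y^-1 * (x * y).                       *)
Inductive tensor_rel : word (G * G) -> word (G * G) -> Prop :=
| TensorMull g g1 h :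
    tensor_rel ((g * g1) ⊗ h) (((g ^ g1) ⊗ (h ^ g1)) ++ (g1 ⊗ h))
| TensorMulr g h h1 :
    tensor_rel (g ⊗ (h * h1)) ((g ⊗ h1) ++ ((g ^ h1) ⊗ (h ^ h1))).

Definition tensor_square : groupType := presented tensor_rel.

End TensorSquare.

Local Open Scope ring_scope.

(* Z[t_1^{+-1}, ..., t_m^{+-1}] is taken inside the field of fractions of     *)
(* Z[t_1, ..., t_m], as the set of Z-linear combinations of the monomials     *)
(* t_1^a_1 ... t_m^a_m with integer exponents.                                *)
Section Laurent.
Variable m : nat.
Local Notation K := {fraction {mpoly int[m]}}.

Definition laurent_monomial (a : {ffun 'I_m -> int}) : K :=
  \prod_(i < m) (tofrac ('X_i : {mpoly int[m]})) ^ (a i).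

Definition laurent_sum (s : seq (int * {ffun 'I_m -> int})) : K :=
  \sum_(c <- s) c.1%:~R * laurent_monomial c.2.

Definition is_laurent : {pred K} := fun x => `[< exists s, x = laurent_sum s >].

Lemma laurent_monomialM a b :
  laurent_monomial a * laurent_monomial b = laurent_monomial (a + b).
Proof.
rewrite -big_split; apply: eq_bigr => i _ /=; rewrite ffunE expfzDr //.
rewrite tofrac_eq0; apply/eqP => /(congr1 (mcoeff U_(i))) /eqP.
by rewrite mcoeffX mcoeff0 eqxx.
Qed.

Fact is_laurent_subring : subring_closed is_laurent.
Proof.
split.
- apply/asboolP; exists [:: (1, 0)].
  rewrite /laurent_sum big_seq1 mul1r /laurent_monomial big1 // => i _.
  by rewrite ffunE.
- move=> x y /asboolP[s ->] /asboolP[t ->]; apply/asboolP.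
  exists (s ++ [seq (- c.1, c.2) | c <- t]).
  rewrite /laurent_sum big_cat big_map -sumrN; congr (_ + _).
  by apply: eq_bigr => c _; rewrite rmorphN mulNr.
- move=> x y /asboolP[s ->] /asboolP[t ->]; apply/asboolP.
  exists [seq (c.1 * d.1, c.2 + d.2) | c <- s, d <- t].
  rewrite /laurent_sum big_allpairs_dep mulr_suml; apply: eq_bigr => c _.
  rewrite mulr_sumr; apply: eq_bigr => d _ /=.
  by rewrite rmorphM -laurent_monomialM mulrACA.
Qed.

HB.instance Definition _ := GRing.isSubringClosed.Build K is_laurent
  is_laurent_subring.

Record laurent : predArgType :=
  Laurent { laurent_val : K; _ : laurent_val \in is_laurent }.
HB.instance Definition _ := [isSub for laurent_val].
HB.instance Definition _ := [Choice of laurent by <:].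
HB.instance Definition _ := [SubChoice_isSubComNzRing of laurent by <:].

(* Units: the elements whose inverse in K is again a Laurent polynomial.      *)
Definition laurent_unit : {pred laurent} :=
  fun x => (val x != 0) && ((val x)^-1 \in is_laurent).
Definition laurent_inv (x : laurent) : laurent := insubd x (val x)^-1.

Fact laurent_mulV : {in laurent_unit, left_inverse 1 laurent_inv *%R}.
Proof.
move=> x /andP[x0 xV]; apply: val_inj.
by rewrite rmorphM rmorph1 /= insubdK // mulVf.
Qed.

Fact laurent_unitP (x y : laurent) : y * x = 1 -> x \in laurent_unit.
Proof.
move=> yx; have yx1 : val y * val x = 1 := congr1 val yx.
have x0 : val x != 0.
  by apply/eqP=> x0; move/eqP: yx1; rewrite x0 mulr0 eq_sym oner_eq0.
apply/andP; split=> //.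
suff -> : (val x)^-1 = val y by apply: valP.
by rewrite -[LHS]mul1r -yx1 mulfK.
Qed.

Fact laurent_inv_out : {in [predC laurent_unit], laurent_inv =1 id}.
Proof.
move=> x /negP xU; apply: val_inj; rewrite val_insubd; case: ifP => // xV.
have [->|x0] := eqVneq (val x) 0; first by rewrite invr0.
by case: xU; apply/andP.
Qed.

HB.instance Definition _ := GRing.ComNzRing_hasMulInverse.Build laurent
  laurent_mulV laurent_unitP laurent_inv_out.

End Laurent.

Section GeneralLinear.
Variables (n : nat) (R : comUnitRingType).

Record GL : predArgType := MkGL { GL_val : 'M[R]_n; _ : GL_val \in unitmx }.
HB.instance Definition _ := [isSub for GL_val].
HB.instance Definition _ := [Choice of GL by <:].

Definition GL_one : GL := MkGL (unitmx1 R n).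

Fact GL_inv_subproof (A : GL) : invmx (val A) \in unitmx.
Proof. by rewrite unitmx_inv (valP A). Qed.
Definition GL_inv (A : GL) : GL := MkGL (GL_inv_subproof A).

Fact GL_mul_subproof (A B : GL) : val A *m val B \in unitmx.
Proof. by rewrite unitmx_mul (valP A) (valP B). Qed.
Definition GL_mul (A B : GL) : GL := MkGL (GL_mul_subproof A B).

Fact GL_mulA : associative GL_mul.
Proof. by move=> A B C; apply: val_inj; apply: mulmxA. Qed.

Fact GL_mul1 : left_id GL_one GL_mul.
Proof. by move=> A; apply: val_inj; apply: mul1mx. Qed.

Fact GL_mulr1 : right_id GL_one GL_mul.
Proof. by move=> A; apply: val_inj; apply: mulmx1. Qed.

Fact GL_mulV : left_inverse GL_one GL_inv GL_mul.
Proof. by move=> A; apply: val_inj; apply: mulVmx (valP A). Qed.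

Fact GL_mulrV : right_inverse GL_one GL_inv GL_mul.
Proof. by move=> A; apply: val_inj; apply: mulmxV (valP A). Qed.

HB.instance Definition _ := isGroup.Build GL
  GL_mulA GL_mul1 GL_mulr1 GL_mulV GL_mulrV.

End GeneralLinear.

(* Main.v *)
Require Import Defs.
From HB Require Import structures.
From mathcomp Require Import all_boot all_order all_fingroup all_algebra.
From mathcomp Require Import generic_quotient boolp mpoly.
From mathcomp Require Import ring zify.

(** Let F be free on x_1, ..., x_n and let T be its tensor square. The boundary
    map bd : T -> F sends g ⊗ h to the commutator of g and h, and for all
    i <= j the product of the exponent sums of x_i in g and of x_j in h is a
    pairing T -> Z. The point is that bd and these n (n + 1) / 2 pairings are
    jointly injective (tensor_free_ker). The representation multiplies a
    faithful representation of F over the integers, applied to bd t, by the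
    scalar t_1^(e_1) ... t_m^(e_m) whose exponents are the pairings of t.

    For joint injectivity, T is a crossed module over F (peiffer, tens_bdl), so
    elements with trivial boundary are central and fixed by F. Since T is
    generated under the action of F by the x_i ⊗ x_j, it is generated by the
    conjugates of the x_k ⊗ x_j with k > j together with the central elements
    x_i ⊗ x_i and (x_i ⊗ x_j) (x_j ⊗ x_i) with i < j. The pairings separate the
    products of these central elements, so it remains to see that bd is
    injective on the subgroup generated by the conjugates of the x_k ⊗ x_j with
    k > j (recovered_gen). This is done by an explicit inverse. Collecting a
    word into the normal form x_1^(a_1) ... x_n^(a_n) writes it as a normal form
    times a product of conjugates of commutators, and doing the same with
    tensors in place of the commutators gives a function from words to T. It
    depends only on the element of F, because on a free group a crossed
    homomorphism can be prescribed on the generators (crossed_word_eq). Letting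
    the collection start at an arbitrary normal form makes the set of the
    elements that it recovers from their boundary stable under F
    (recovered_act), so that only the x_k ⊗ x_j have to be checked, and they
    satisfy the required identity (high_tens_exchange).

    Faithfulness of the representation of F is a ping-pong argument on the
    projective line: the generator x_i acts by a parabolic matrix fixing 2 i,
    and a nontrivial reduced word moves the point at infinity into one of the
    disjoint intervals next to the points 2 i. *)

Set Implicit Arguments.
Unset Strict Implicit.
Unset Printing Implicit Defensive.

Import Order.TTheory GRing.Theory Num.Theory.
Local Open Scope group_scope.

(** * The universal property of a presented group *)

Section PresentedGroups.
Variables (X : choiceType) (rel_ : word X -> word X -> Prop).
Local Notation cls := (pres_class rel_).

Lemma pres_classM u v : cls (u ++ v) = cls u * cls v.
Proof. by rewrite -pres_mulE. Qed.

Lemma pres_classV u : cls (inv_word u) = (cls u)^-1.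
Proof. by rewrite -pres_invE. Qed.

Definition pres_gen (x : X) : presented rel_ := cls (gen_word x).

Definition letter_val (H : groupType) (f : X -> H) (l : X * bool) : H :=
  if l.2 then (f l.1)^-1 else f l.1.

Lemma pres_class_cons l w : cls (l :: w) = letter_val pres_gen l * cls w.
Proof.
by case: l => x []; rewrite -cat1s pres_classM //= /letter_val /= -pres_classV.
Qed.

Lemma pres_ind (P : presented rel_ -> Prop) :
  P 1 -> (forall x, P (pres_gen x)) -> (forall a b, P a -> P b -> P (a * b)) ->
  (forall a, P a -> P a^-1) -> forall a, P a.
Proof.
move=> P1 Pg PM PV a; rewrite -(pres_reprK a).
elim: (repr a) => [//|[x b] w ih]; rewrite pres_class_cons.
by apply: PM => //; case: b; rewrite /letter_val /=; [apply: PV|].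
Qed.

Definition word_val (H : groupType) (f : X -> H) (w : word X) : H :=
  \prod_(l <- w) letter_val f l.

Definition respects (H : groupType) (f : X -> H) :=
  forall r s, rel_ r s -> word_val f r = word_val f s.

Section Lift.
Variables (H : groupType) (f : X -> H) (fP : respects f).

Lemma word_val_eq w1 w2 : pres_eq rel_ w1 w2 -> word_val f w1 = word_val f w2.
Proof.
elim=> [u v r s /fP rs|u v x b|//|//|? ? ? _ -> _ -> //].
  by move: rs; rewrite /word_val !big_cat /= => ->.
rewrite /word_val !big_cat !big_cons /=; congr (_ * _).
by case: b; rewrite /letter_val /= ?mulKg ?mulVKg.
Qed.

Definition pres_lift of respects f := fun a : presented rel_ =>
  word_val f (repr a).

Lemma pres_lift_class w : pres_lift fP (cls w) = word_val f w.
Proof. exact/word_val_eq/pres_classP/pres_reprK. Qed.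

Fact pres_lift_morph : {morph pres_lift fP : a b / a * b}.
Proof.
move=> a b; rewrite -(pres_reprK a) -(pres_reprK b) -pres_classM.
by rewrite !pres_lift_class /word_val big_cat.
Qed.

Fact pres_lift_div : {morph pres_lift fP : a b / a * b^-1}.
Proof.
by move=> a b; apply: (canRL (mulgK _)); rewrite -pres_lift_morph mulgVK.
Qed.

HB.instance Definition _ :=
  isGroupMorphism.Build (presented rel_) H (pres_lift fP) pres_lift_div.

Lemma pres_lift_gen x : pres_lift fP (pres_gen x) = f x.
Proof. by rewrite pres_lift_class /word_val big_seq1. Qed.

End Lift.

End PresentedGroups.

(** * The tensor square and its universal property *)

Section TensorSquare.
Variable G : groupType.
Local Notation T := (tensor_square G).

Definition tens (g h : G) : T := pres_gen (@tensor_rel G) (g, h).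

Lemma tensMl g g1 h : tens (g * g1) h = tens (g ^ g1) (h ^ g1) * tens g1 h.
Proof.
rewrite /tens /pres_gen -pres_classM; apply/pres_classP.
have := PresRel [::] [::] (TensorMull g g1 h).
by rewrite !cats0.
Qed.

Lemma tensMr g h h1 : tens g (h * h1) = tens g h1 * tens (g ^ h1) (h ^ h1).
Proof.
rewrite /tens /pres_gen -pres_classM; apply/pres_classP.
have := PresRel [::] [::] (TensorMulr g h h1).
by rewrite !cats0.
Qed.

Lemma tens1g h : tens 1 h = 1.
Proof.
have := tensMl 1 1 h; rewrite mulg1 !conjg1.
by move/(congr1 (fun t => t * (tens 1 h)^-1)); rewrite mulgV mulgK.
Qed.

Lemma tensg1 g : tens g 1 = 1.
Proof.
have := tensMr g 1 1; rewrite mulg1 !conjg1.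
by move/(congr1 (fun t => t * (tens g 1)^-1)); rewrite mulgV mulgK.
Qed.

Lemma tens_ind (P : T -> Prop) :
  P 1 -> (forall g h, P (tens g h)) -> (forall a b, P a -> P b -> P (a * b)) ->
  (forall a, P a -> P a^-1) -> forall a, P a.
Proof. by move=> P1 Pg PM PV; apply: pres_ind => // -[]. Qed.

Section Lift.
Variables (H : groupType) (f : G -> G -> H).
Hypothesis fMl : forall g g1 h, f (g * g1) h = f (g ^ g1) (h ^ g1) * f g1 h.
Hypothesis fMr : forall g h h1, f g (h * h1) = f g h1 * f (g ^ h1) (h ^ h1).

Fact tens_respects : respects (@tensor_rel G) (fun p => f p.1 p.2).
Proof.
by move=> r s [g g1 h|g h h1]; rewrite /word_val /= !(big_cons, big_nil)
  /letter_val /= !mulg1; [apply: fMl|apply: fMr].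
Qed.

Definition tens_lift : T -> H := pres_lift tens_respects.
HB.instance Definition _ := isGroupMorphism.Build T H tens_lift
  (pres_lift_div tens_respects).

Lemma tens_liftE g h : tens_lift (tens g h) = f g h.
Proof. exact: pres_lift_gen. Qed.
End Lift.

Section Action.
Variable x : G.
Fact act_respectsMl g g1 h :
  tens ((g * g1) ^ x) (h ^ x) =
  tens ((g ^ g1) ^ x) ((h ^ g1) ^ x) * tens (g1 ^ x) (h ^ x).
Proof. by rewrite conjMg tensMl -!conjJg. Qed.
Fact act_respectsMr g h h1 :
  tens (g ^ x) ((h * h1) ^ x) =
  tens (g ^ x) (h1 ^ x) * tens ((g ^ h1) ^ x) ((h ^ h1) ^ x).
Proof. by rewrite conjMg tensMr -!conjJg. Qed.

(** The diagonal action of G on its tensor square, written t ↑ x below: with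
    it the defining relations say that tens is a crossed homomorphism in each
    of its arguments. *)
Definition tens_act : T -> T := tens_lift act_respectsMl act_respectsMr.
HB.instance Definition _ := isGroupMorphism.Build T T tens_act
  (pres_lift_div (tens_respects act_respectsMl act_respectsMr)).
End Action.
End TensorSquare.

(** * The tensor square as a crossed module *)

Local Notation "t ↑ x" := (tens_act x t) (at level 29, left associativity).

Section CrossedModule.
Variable G : groupType.
Local Notation T := (tensor_square G).
Implicit Types (g h x y : G) (s t : T).

Lemma tens_act_tens x g h : tens g h ↑ x = tens (g ^ x) (h ^ x).
Proof. exact: tens_liftE. Qed.

Lemma tens_act1g x : (1 : T) ↑ x = 1.
Proof. exact: gmulf1. Qed.

Lemma tens_actMg x s t : (s * t) ↑ x = s ↑ x * t ↑ x.
Proof. exact: gmulfM. Qed.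

Lemma tens_actVg x t : t^-1 ↑ x = (t ↑ x)^-1.
Proof. exact: gmulfV. Qed.

Lemma tens_actg1 t : t ↑ 1 = t.
Proof.
elim/tens_ind: t => [|g h|a b ea eb|a ea].
- by rewrite tens_act1g.
- by rewrite tens_act_tens !conjg1.
- by rewrite tens_actMg ea eb.
- by rewrite tens_actVg ea.
Qed.

Lemma tens_actM x y t : t ↑ (x * y) = t ↑ x ↑ y.
Proof.
elim/tens_ind: t => [|g h|a b ea eb|a ea].
- by rewrite !tens_act1g.
- by rewrite !tens_act_tens !conjgM.
- by rewrite !tens_actMg ea eb.
- by rewrite !tens_actVg ea.
Qed.

Lemma tens_actK x t : t ↑ x ↑ x^-1 = t.
Proof. by rewrite -tens_actM mulgV tens_actg1. Qed.

Lemma tens_actKV x t : t ↑ x^-1 ↑ x = t.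
Proof. by rewrite -tens_actM mulVg tens_actg1. Qed.

Lemma tensVg g h : tens g^-1 h = (tens g h)^-1 ↑ g^-1.
Proof.
have := tensMl g g^-1 h; rewrite mulgV tens1g -tens_act_tens => e.
by rewrite tens_actVg; apply/esym/mulg1_eq.
Qed.

Lemma tensgV g h : tens g h^-1 = (tens g h)^-1 ↑ h^-1.
Proof.
have := tensMr g h h^-1; rewrite mulgV tensg1 -tens_act_tens => e.
by rewrite tens_actVg -(mulg1_eq (esym e)) invgK.
Qed.

Fact comm_respectsMl g g1 h :
  [~ g * g1, h] = [~ g ^ g1, h ^ g1] * [~ g1, h].
Proof. by rewrite -conjRg /commg /conjg !invgM !mulgA !(mulgK, mulgKV). Qed.

Fact comm_respectsMr g h h1 :
  [~ g, h * h1] = [~ g, h1] * [~ g ^ h1, h ^ h1].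
Proof. by rewrite -conjRg /commg /conjg !invgM !mulgA !(mulgK, mulgKV). Qed.

(** The boundary map of the crossed module; its image is the derived subgroup
    of G. *)
Definition bd : T -> G := tens_lift comm_respectsMl comm_respectsMr.
HB.instance Definition _ := isGroupMorphism.Build T G bd
  (pres_lift_div (tens_respects comm_respectsMl comm_respectsMr)).

Lemma bd1 : bd 1 = 1.
Proof. exact: gmulf1. Qed.

Lemma bdM s t : bd (s * t) = bd s * bd t.
Proof. exact: gmulfM. Qed.

Lemma bdV t : bd t^-1 = (bd t)^-1.
Proof. exact: gmulfV. Qed.

Lemma bd_tens g h : bd (tens g h) = [~ g, h].
Proof. exact: tens_liftE. Qed.

Lemma bd_act x t : bd (t ↑ x) = bd t ^ x.
Proof.
elim/tens_ind: t => [|g h|a b ea eb|a ea].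
- by rewrite tens_act1g bd1 conj1g.
- by rewrite tens_act_tens !bd_tens conjRg.
- by rewrite tens_actMg !bdM conjMg ea eb.
- by rewrite tens_actVg !bdV conjVg ea.
Qed.

(** Both sides come from expanding (g g1) ⊗ (h h1), once in the second
    argument first and once in the first argument first, and cancelling the
    common outer factors. *)
Lemma tens_exchange g h g1 h1 :
  tens g1 h1 * tens g h ↑ (g1 * h1) = tens g h ↑ (h1 * g1) * tens g1 h1.
Proof.
have eR : tens (g * g1) (h * h1) =
    (tens g h1 ↑ g1 * tens g1 h1) * (tens g h ↑ g1 * tens g1 h) ↑ h1.
  by rewrite tensMr -tens_act_tens (tensMl g) (tensMl g g1 h) -!tens_act_tens.
have eL : tens (g * g1) (h * h1) =
    (tens g h1 * tens g h ↑ h1) ↑ g1 * (tens g1 h1 * tens g1 h ↑ h1).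
  by rewrite tensMl -tens_act_tens (tensMr g) (tensMr g1) -!tens_act_tens.
move: eR; rewrite eL !tens_actMg -!tens_actM !mulgA => /mulIg.
by rewrite -!mulgA => /mulgI.
Qed.

(** The Peiffer identity: on tensors it is the exchange law, since the two
    exponents there differ by the commutator that is the boundary of tens g1
    h1. *)
Lemma peiffer s t : t ↑ bd s = t ^ s.
Proof.
elim/tens_ind: s t => [t|g1 h1 t|a b ea eb t|a ea t].
- by rewrite bd1 tens_actg1 conjg1.
- rewrite bd_tens; elim/tens_ind: t => [|g h|a b ea eb|a ea].
  + by rewrite tens_act1g conj1g.
  + have cE : (h1 * g1)^-1 * (g1 * h1) = [~ g1, h1].
      by rewrite /commg /conjg invgM !mulgA.
    have := tens_exchange (g ^ (h1 * g1)^-1) (h ^ (h1 * g1)^-1) g1 h1.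
    rewrite -tens_act_tens -2!tens_actM cE mulVg tens_actg1 => e.
    by rewrite conjgE -e mulKg.
  + by rewrite tens_actMg ea eb conjMg.
  + by rewrite tens_actVg ea conjVg.
- by rewrite bdM tens_actM ea eb conjgM.
- by rewrite -{1}[t](conjgKV a) -ea bdV tens_actK.
Qed.

(** Both sides are crossed homomorphisms in t for the action of T through bd,
    so it suffices to compare them on a tensor. There the commutator of g and
    h is g^-1 (g ^ h), and g ⊗ h x can be expanded through h x = (x ^ h^-1) h. *)
Lemma tens_bdl t x : tens (bd t) x = t^-1 * t ↑ x.
Proof.
elim/tens_ind: t => [|g h|a b ea eb|a ea].
- by rewrite bd1 tens1g tens_act1g mulVg.
- rewrite bd_tens commgEl tensMl -tens_act_tens tensVg.
  rewrite -tens_actM -commgEl -bd_tens peiffer.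
  have e : tens g h * tens (g ^ h) x = tens g x * tens g h ↑ x.
    rewrite (tens_act_tens x) -tensMr -{2}[x](conjgKV h) -conjgC tensMr.
    by rewrite conjgKV.
  rewrite -[tens (g ^ h) x](mulKg (tens g h)) e /conjg.
  by rewrite !mulgA !(mulgK, mulgKV, mulgVK).
- rewrite bdM tens_actMg tensMl -tens_act_tens peiffer ea eb.
  rewrite /conjg invgM !mulgA.
  by rewrite !(mulgK, mulgKV, mulgVK).
- rewrite bdV tensVg -bdV peiffer ea tens_actVg conjgE !invgM !invgK.
  by rewrite !mulgA mulgK.
Qed.

Lemma ker_bd_central t s : bd t = 1 -> commute t s.
Proof.
by move=> t1; rewrite /commute (conjgC s) -peiffer t1 tens_actg1.
Qed.

(** With bd t = 1 the left side of tens_bdl is 1 ⊗ x, which is trivial. *)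
Lemma ker_bd_fixed t x : bd t = 1 -> t ↑ x = t.
Proof.
move=> t1; have := tens_bdl t x; rewrite t1 tens1g => /esym/mulg1_eq <-.
exact: invgK.
Qed.

End CrossedModule.

(** * Free groups *)

Section AdditiveGroup.
Variable V : zmodType.
(** The additive group of V, as a target for morphisms of multiplicative
    groups. *)
Definition addg : Type := V.
HB.instance Definition _ := Choice.on addg.
HB.instance Definition _ := isGroup.Build addg
  (@GRing.addrA V) (@GRing.add0r V) (@GRing.addr0 V)
  (@GRing.addNr V) (@GRing.addrN V).
End AdditiveGroup.

Section FreeGroup.
Variable n : nat.
Local Notation F := (free_group n).
Local Notation cls := (pres_class (fun _ _ : word 'I_n => False)).

Definition fgen (i : 'I_n) : F := pres_gen _ i.

Lemma free_ind (P : F -> Prop) :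
  P 1 -> (forall i, P (fgen i)) -> (forall a b, P a -> P b -> P (a * b)) ->
  (forall a, P a -> P a^-1) -> forall a, P a.
Proof. exact: pres_ind. Qed.

Section Lift.
Variables (H : groupType) (f : 'I_n -> H).

Fact free_respects : respects (fun _ _ : word 'I_n => False) f.
Proof. by []. Qed.

Definition free_lift : F -> H := pres_lift free_respects.
HB.instance Definition _ := isGroupMorphism.Build F H free_lift
  (pres_lift_div free_respects).

Lemma free_lift_gen i : free_lift (fgen i) = f i.
Proof. exact: pres_lift_gen. Qed.
End Lift.

(** The retraction of F onto the infinite cyclic group of its i-th generator,
    which sends g to x_i raised to the exponent sum of x_i in g. This form
    avoids integer powers in F. The index is a natural number so that products
    over intervals of indices can be split. *)
Definition retract (i : nat) : F -> F :=
  free_lift (fun j => if i == j then fgen j else 1).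
HB.instance Definition _ i := UMagmaMorphism.on (retract i).

Lemma retract_gen (i : 'I_n) : retract i (fgen i) = fgen i.
Proof. by rewrite /retract free_lift_gen eqxx. Qed.

Lemma retract_gen0 (i : nat) (j : 'I_n) : i != j -> retract i (fgen j) = 1.
Proof. by rewrite /retract free_lift_gen => /negbTE->. Qed.

Lemma retract_commute i g h : commute (retract i g) (retract i h).
Proof.
elim/free_ind: h => [|j|a b ca cb|a ca].
- by rewrite gmulf1; apply: commute1.
- rewrite {2}/retract free_lift_gen.
  case: eqP => [->|_]; last exact: commute1.
  apply: commute_sym; elim/free_ind: g => [|k|a b ca cb|a ca].
  + by rewrite gmulf1; apply: commute1.
  + rewrite /retract free_lift_gen; case: eqP => [/val_inj->//|_].
    exact: commute1.
  + by rewrite gmulfM; apply: commuteM.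
  + by rewrite gmulfV; apply: commuteV.
- by rewrite gmulfM; apply: commuteM.
- by rewrite gmulfV; apply: commuteV.
Qed.

(** The part above j of the normal form of the class of g in the
    abelianization, that is, the product of the powers x_i^(a_i) in increasing
    order of i > j, where a_i is the exponent sum of x_i in g. *)
Definition high (j : nat) (g : F) : F := \prod_(j.+1 <= i < n) retract i g.

(** The boundary of a tensor is a commutator, which retract i kills because
    its image is commutative. *)
Lemma high_bd j g t : high j (g * bd t) = high j g.
Proof.
apply: eq_bigr => i _; rewrite gmulfM /=.
suff -> : retract i (bd t) = 1 by rewrite mulg1.
elim/tens_ind: t => [|x y|a b ea eb|a ea].
- by rewrite bd1 gmulf1.
- by rewrite bd_tens gmulfR; apply/eqP/commgP/retract_commute.
- by rewrite bdM gmulfM /= ea eb mulg1.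
- by rewrite bdV gmulfV /= ea invg1.
Qed.

Lemma high_low j (k : 'I_n) g : k <= j -> high j (g * fgen k) = high j g.
Proof.
move=> kj; apply: eq_big_nat => i /andP[ji _].
by rewrite gmulfM /= retract_gen0 ?mulg1 // gtn_eqF // (leq_ltn_trans kj).
Qed.

(** Moving x_k leftwards past the powers of the generators above k, to its
    place in the normal form, costs one commutator. *)
Lemma high_step (j k : 'I_n) g : j < k ->
  high j g * fgen k = high j (g * fgen k) * [~ high k g, fgen k].
Proof.
move=> jk.
have split h : high j h =
    \prod_(j.+1 <= i < k) retract i h * (retract k h * high k h).
  rewrite /high (@big_cat_nat _ _ _ k) ?(ltnW (ltn_ord k)) //=.
  by rewrite [X in _ * X]big_ltn.
rewrite !split (@high_low k k) // gmulfM /= retract_gen.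
have -> : \prod_(j.+1 <= i < k) retract i (g * fgen k) =
    \prod_(j.+1 <= i < k) retract i g.
  apply: eq_big_nat => i /andP[_ ik].
  by rewrite gmulfM /= retract_gen0 ?mulg1 // ltn_eqF.
by rewrite /commg /conjg !mulgA !(mulgK, mulgKV).
Qed.

Local Notation T := (tensor_square F).

Section Crossed.
Variable d : 'I_n -> F -> T.

(** The function D with D (g, x_i) = d i g and D (g, u v) = D (g u, v) (D (g,
    u) ↑ v). Since F is free, the values d can be chosen arbitrarily: the
    value on an inverse letter is the one that makes D (g, x x^-1) trivial. *)
Fixpoint crossed_word (g : F) (w : word 'I_n) : T :=
  if w is (x, b) :: w' then
    crossed_word (g * letter_val fgen (x, b)) w' *
    (if b then (d x (g * (fgen x)^-1))^-1 ↑ (fgen x)^-1 else d x g) ↑ cls w'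
  else 1.

Lemma crossed_word_cat g u v :
  crossed_word g (u ++ v) =
  crossed_word (g * cls u) v * crossed_word g u ↑ cls v.
Proof.
elim: u g => [|[x b] u ih] g /=.
  by rewrite tens_act1g mulg1 -[cls [::]]/(1 : F) mulg1.
rewrite ih pres_class_cons !mulgA tens_actMg -tens_actM.
by rewrite mulgA (pres_classM _ u).
Qed.

Lemma crossed_word_eq g u v :
  pres_eq (fun _ _ => False) u v -> crossed_word g u = crossed_word g v.
Proof.
move=> uv; elim: uv g => {u v} [//|u v x b g|//|//|u v w _ uv _ vw g].
  have cE : cls [:: (x, b); (x, ~~ b)] = 1.
    by apply/pres_classP/(PresCancel _ [::] [::]).
  suff dE h : crossed_word h [:: (x, b); (x, ~~ b)] = 1.
    rewrite -[_ :: v]cat1s -cat_cons !crossed_word_cat dE.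
    by rewrite pres_classM cE mul1g mulg1 tens_act1g mulg1.
  rewrite /= mul1g tens_actg1 pres_class_cons !tens_actM tens_actg1.
  case: b {cE}; rewrite /letter_val /= -/(fgen x).
    by rewrite tens_actKV mulgV.
  by rewrite mulgK -tens_actMg mulVg tens_act1g.
by rewrite uv vw.
Qed.

Definition crossed (g h : F) : T := crossed_word g (repr h).

Lemma crossed_class g w : crossed g (cls w) = crossed_word g w.
Proof. exact/crossed_word_eq/pres_classP/pres_reprK. Qed.

Lemma crossed1 g : crossed g 1 = 1.
Proof. exact: (crossed_class g [::]). Qed.

Lemma crossed_gen g i : crossed g (fgen i) = d i g.
Proof. by rewrite crossed_class /= mul1g -[cls [::]]/(1 : F) tens_actg1. Qed.

Lemma crossedM g h k :
  crossed g (h * k) = crossed (g * h) k * crossed g h ↑ k.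
Proof.
rewrite -(pres_reprK h) -(pres_reprK k) -pres_classM !crossed_class.
exact: crossed_word_cat.
Qed.

(* The values of bd are the elements of F': d i is a function on F / F'. *)
Hypothesis d_bd : forall i g t, d i (g * bd t) = d i g.

Lemma crossed_bd g t h : crossed (g * bd t) h = crossed g h.
Proof.
rewrite /crossed; elim: (repr h) g t => [//|[x b] w ih] g t /=.
have step l : g * bd t * l = g * l * bd (t ↑ l).
  by rewrite bd_act -!mulgA -conjgC.
rewrite step ih; congr (_ * _ ↑ _); case: b => //.
by rewrite step d_bd.
Qed.

(** The elements t for which crossed is a section of bd, for every base point.
    Quantifying over the base point is what makes this set stable under the
    action of F. A recovered element with trivial boundary is trivial. *)
Definition recovered t := forall g, crossed g (bd t) = t.

Lemma recovered1 : recovered 1.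
Proof. by move=> g; rewrite bd1 crossed1. Qed.

(** Since bd s lies in F', it does not move the base point, and its action on
    D (g, bd s) = s is conjugation. *)
Lemma recoveredM s t : recovered s -> recovered t -> recovered (s * t).
Proof.
by move=> sR tR g; rewrite bdM crossedM tR sR peiffer -conjgC.
Qed.

Lemma recoveredV t : recovered t -> recovered t^-1.
Proof.
move=> tR g; have := crossedM g (bd t) (bd t^-1).
rewrite -bdM mulgV bd1 crossed1 crossed_bd tR peiffer conjgE mulgV mulg1 invgK.
by move/esym/mulg1_eq/(congr1 (fun u => u^-1)); rewrite invgK.
Qed.

(** Expanding D (g, x^-1 (bd t) x) leaves t ↑ x and the two contributions of
    x^-1 and x, which cancel because bd t acts on the first of them as
    conjugation by t. *)
Lemma recovered_act t x : recovered t -> recovered (t ↑ x).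
Proof.
move=> tR g; rewrite bd_act conjgE !crossedM crossed_bd tR.
rewrite tens_actM peiffer -mulgA -tens_actMg conjgE mulVKg tens_actMg mulgA.
by rewrite -crossedM mulVg crossed1 mul1g.
Qed.

End Crossed.

(** The tensor whose boundary is the commutator that appears when a letter x_j
    is collected into the normal form of g. *)
Definition high_tens (j : 'I_n) (g : F) : T := tens (high j g) (fgen j).

Lemma high_tens_bd j g t : high_tens j (g * bd t) = high_tens j g.
Proof. by rewrite /high_tens high_bd. Qed.

Local Notation D := (crossed high_tens).

(** Write r = (high k g) ⊗ x_k. By high_step, (high j g) x_k = (high j (g
    x_k)) (bd r), so expanding (high j g) x_k ⊗ x_j in two ways, and replacing
    (bd r) ⊗ x_j by r^-1 (r ↑ x_j), gives the identity. This is where the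
    relations of the tensor square of F enter. *)
Lemma high_tens_exchange (j k : 'I_n) g : j < k ->
  D g (fgen k * fgen j) = D g (fgen j * fgen k) * tens (fgen k) (fgen j).
Proof.
move=> jk; rewrite !crossedM !crossed_gen -mulgA.
have -> : high_tens k (g * fgen j) = high_tens k g.
  by rewrite /high_tens high_low // ltnW.
set r := high_tens k g.
have -> : high_tens j g ↑ fgen k * tens (fgen k) (fgen j) =
    tens (high j g * fgen k) (fgen j) by rewrite tensMl -tens_act_tens.
rewrite high_step // -bd_tens -/(high_tens k g) -/r tensMl.
rewrite -tens_act_tens peiffer.
by rewrite tens_bdl conjgE !mulgA mulgV mul1g mulgK.
Qed.

(** Both sides of x_k x_j = x_j x_k [x_k, x_j] have the same D; comparing with
    high_tens_exchange determines D on the commutator. *)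
Lemma recovered_gen (j k : 'I_n) : j < k ->
  recovered high_tens (tens (fgen k) (fgen j)).
Proof.
move=> jk g; set t := tens _ _.
pose h := g * (fgen j * fgen k)^-1.
have := crossedM high_tens h (fgen j * fgen k) (bd t).
have -> : fgen j * fgen k * bd t = fgen k * fgen j by rewrite bd_tens -commgC.
rewrite high_tens_exchange // -/t peiffer (conjgC _ t) => /mulIg /esym.
by rewrite /h mulgVK.
Qed.

End FreeGroup.

(** * The kernel of the boundary map of a free group *)

Section Kernel.
Variable n : nat.
Implicit Types (p q : 'I_n * 'I_n).
Local Notation F := (free_group n).
Local Notation T := (tensor_square F).
Local Notation x_ := (@fgen n).
Local Notation recovered := (recovered (@high_tens n)).

Definition expo (i : 'I_n) : F -> addg int :=
  free_lift (fun j => (i == j)%:R%R : addg int).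
HB.instance Definition _ i := UMagmaMorphism.on (expo i).

Lemma expoM i g h : expo i (g * h) = (expo i g + expo i h)%R.
Proof. exact: gmulfM. Qed.

Lemma expo_gen i j : expo i (x_ j) = (i == j)%:R%R.
Proof. exact: free_lift_gen. Qed.

Lemma expoJ i g h : expo i (g ^ h) = expo i g.
Proof.
by apply: (@addrI int (expo i h)); rewrite -expoM -conjgC expoM addrC.
Qed.

Section Pairing.
Variable p : 'I_n * 'I_n.
Definition pairing_gen (g h : F) : addg int := (expo p.1 g * expo p.2 h)%R.

Fact pairing_respectsMl g g1 h : pairing_gen (g * g1) h =
  pairing_gen (g ^ g1) (h ^ g1) * pairing_gen g1 h.
Proof. by rewrite /pairing_gen expoM !expoJ mulrDl. Qed.

Fact pairing_respectsMr g h h1 : pairing_gen g (h * h1) =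
  pairing_gen g h1 * pairing_gen (g ^ h1) (h ^ h1).
Proof. by rewrite /pairing_gen expoM !expoJ mulrDr addrC. Qed.

Definition pairing : T -> addg int :=
  tens_lift pairing_respectsMl pairing_respectsMr.
HB.instance Definition _ := UMagmaMorphism.on pairing.

Lemma pairingM s t : pairing (s * t) = (pairing s + pairing t)%R.
Proof. exact: gmulfM. Qed.

Lemma pairing1 : pairing 1 = 0%R.
Proof. exact: gmulf1. Qed.

Lemma pairing_tens g h : pairing (tens g h) = (expo p.1 g * expo p.2 h)%R.
Proof. exact: tens_liftE. Qed.
End Pairing.

(** A basis of the kernel of bd, indexed by the pairs with p.1 <= p.2. *)
Definition sym_tens (p : 'I_n * 'I_n) : T :=
  if p.1 == p.2 then tens (x_ p.1) (x_ p.1)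
  else tens (x_ p.1) (x_ p.2) * tens (x_ p.2) (x_ p.1).

Lemma bd_sym_tens p : bd (sym_tens p) = 1.
Proof.
rewrite /sym_tens; case: ifP => _; first by rewrite bd_tens commgg.
by rewrite bdM !bd_tens -(invgR (x_ p.1)) mulgV.
Qed.

Lemma pairing_sym_tens (p q : 'I_n * 'I_n) : p.1 <= p.2 -> q.1 <= q.2 ->
  pairing p (sym_tens q) = (q == p)%:R%R.
Proof.
case: p q => [i j] [k l] /= ij kl; rewrite /sym_tens /= xpair_eqE.
have [<-|nkl] := eqVneq k l; rewrite ?pairingM !pairing_tens /= !expo_gen.
  by rewrite -natrM mulnb !(eq_sym k).
have lt_kl : k < l by rewrite ltn_neqAle nkl.
rewrite -!natrM !mulnb -natrD !(eq_sym _ i) !(eq_sym _ j).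
suff -> : (i == l) && (j == k) = false by rewrite addn0.
apply/negP=> /andP[/eqP il /eqP jk].
by move: ij; rewrite il jk leqNgt lt_kl.
Qed.

Definition sym_prod (L : seq ('I_n * 'I_n)) : T := \prod_(p <- L) sym_tens p.

Lemma bd_sym_prod L : bd (sym_prod L) = 1.
Proof.
rewrite /sym_prod; elim: L => [|p L ih]; first by rewrite big_nil bd1.
by rewrite big_cons bdM ih bd_sym_tens mulg1.
Qed.

Lemma sym_prod_cat L L' : sym_prod (L ++ L') = sym_prod L * sym_prod L'.
Proof. exact: big_cat. Qed.

Lemma sym_prodC L t : commute (sym_prod L) t.
Proof. exact/ker_bd_central/bd_sym_prod. Qed.

Lemma sym_prod_perm L L' : perm_eq L L' -> sym_prod L = sym_prod L'.
Proof.
move=> LL'.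
apply: (@catCA_perm_ind _ (fun M => sym_prod L = sym_prod M)) LL' _ => //.
by move=> L1 L2 L3 ->; rewrite !sym_prod_cat !mulgA (sym_prodC L1).
Qed.

Local Notation ordered := (all (fun p : 'I_n * 'I_n => p.1 <= p.2)).

Lemma pairing_sym_prod p L : p.1 <= p.2 -> ordered L ->
  pairing p (sym_prod L) = (count_mem p L)%:R%R.
Proof.
move=> p12; elim: L => [_|q L ih /= /andP[q12 L12]].
  by rewrite /sym_prod big_nil pairing1.
rewrite -cat1s sym_prod_cat pairingM ih // /sym_prod big_seq1.
by rewrite pairing_sym_tens // natrD.
Qed.

(** The subgroup generated by the sym_tens p with p.1 <= p.2: as these are
    central, an element of it is a quotient of two products without inverses. *)
Definition sym_span t := exists L L',
  [/\ ordered L, ordered L' & t * sym_prod L' = sym_prod L].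

Lemma sym_span_bd t : sym_span t -> bd t = 1.
Proof.
by case=> L [L' [_ _ /(congr1 (@bd _))]]; rewrite bdM !bd_sym_prod mulg1.
Qed.

Lemma sym_span1 : sym_span 1.
Proof. by exists [::], [::]; split=> //; rewrite mul1g. Qed.

Lemma sym_span_sym (p : 'I_n * 'I_n) : p.1 <= p.2 -> sym_span (sym_tens p).
Proof.
move=> p12; exists [:: p], [::]; split; rewrite /= ?p12 //.
by rewrite /sym_prod big_seq1 big_nil mulg1.
Qed.

Lemma sym_spanM s t : sym_span s -> sym_span t -> sym_span (s * t).
Proof.
case=> L1 [M1 [oL1 oM1 e1]] [L2 [M2 [oL2 oM2 e2]]].
exists (L1 ++ L2), (M1 ++ M2); split; rewrite ?all_cat ?oL1 ?oM1 //.
rewrite !sym_prod_cat -e1 -e2 -!mulgA; congr (_ * _).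
by rewrite !mulgA (sym_prodC M1 t).
Qed.

Lemma sym_spanV t : sym_span t -> sym_span t^-1.
Proof.
by case=> L [M [oL oM e]]; exists M, L; split=> //; rewrite -e mulKg.
Qed.

(** If t is the quotient of the products over L and M, then the pairing p
    takes on t the difference of the multiplicities of p in L and M. When all
    vanish, L and M are permutations of each other. *)
Lemma sym_span_ker t : sym_span t ->
  (forall p : 'I_n * 'I_n, p.1 <= p.2 -> pairing p t = 0%R) -> t = 1.
Proof.
case=> L [M [oL oM e]] t0; apply: (mulIg (sym_prod M)); rewrite mul1g e.
apply/sym_prod_perm/allP => p; rewrite mem_cat => pLM.
have p12 : p.1 <= p.2 by case/orP: pLM; [move/(allP oL)|move/(allP oM)].
have := congr1 (pairing p) e.
rewrite pairingM t0 // add0r !pairing_sym_prod // => /eqP.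
by rewrite eqr_nat eq_sym.
Qed.

Definition splits t := exists s z, [/\ recovered s, sym_span z & t = s * z].

Lemma splits1 : splits 1.
Proof.
exists 1, 1; split; rewrite ?mulg1 //; [exact: recovered1|exact: sym_span1].
Qed.

Lemma splitsM s t : splits s -> splits t -> splits (s * t).
Proof.
case=> s1 [z1 [r1 c1 ->]] [s2 [z2 [r2 c2 ->]]].
exists (s1 * s2), (z1 * z2); split; [exact: recoveredM|exact: sym_spanM|].
rewrite -!mulgA; congr (_ * _); rewrite !mulgA; congr (_ * _).
exact/ker_bd_central/sym_span_bd.
Qed.

Lemma splitsV t : splits t -> splits t^-1.
Proof.
case=> s [z [r c ->]]; exists s^-1, z^-1; split; [|exact: sym_spanV|].
- apply: recoveredV r; exact: high_tens_bd.
- by rewrite -invgM (ker_bd_central _ (sym_span_bd c)).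
Qed.

Lemma splits_act t x : splits t -> splits (t ↑ x).
Proof.
case=> s [z [r c ->]]; exists (s ↑ x), z; split=> //.
- apply: recovered_act r; exact: high_tens_bd.
- by rewrite tens_actMg (ker_bd_fixed x (sym_span_bd c)).
Qed.

(** For i < j the tensor x_i ⊗ x_j is, up to a central factor, the inverse of
    x_j ⊗ x_i, which is recovered; the tensors x_i ⊗ x_i are themselves
    central. *)
Lemma splits_gen i j : splits (tens (x_ i) (x_ j)).
Proof.
have [ij|ji|/val_inj->] := ltngtP i j.
- exists (tens (x_ j) (x_ i))^-1, (sym_tens (i, j)); split.
  + apply: recoveredV (recovered_gen ij); exact: high_tens_bd.
  + by apply: sym_span_sym; apply: ltnW.
  + rewrite -(ker_bd_central _ (bd_sym_tens _)) /sym_tens /=.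
    by rewrite -val_eqE /= ltn_eqF // mulgK.
- exists (tens (x_ i) (x_ j)), 1; split; rewrite ?mulg1 //.
  + exact: recovered_gen.
  + exact: sym_span1.
- exists 1, (sym_tens (j, j)); split.
  + exact: recovered1.
  + exact: sym_span_sym.
  + by rewrite /sym_tens eqxx mul1g.
Qed.

(** The crossed bilinearity of tens reduces everything to tensors of
    generators, the decomposable elements being a subgroup stable under F. *)
Lemma splits_all t : splits t.
Proof.
elim/tens_ind: t => [|g h|s t|t];
  [exact: splits1| |exact: splitsM|exact: splitsV].
elim/free_ind: h g => [g|j g|h1 h2 s1 s2 g|h s1 g].
- by rewrite tensg1; apply: splits1.
- elim/free_ind: g => [|i|g1 g2 s1 s2|g s1].
  + by rewrite tens1g; apply: splits1.
  + exact: splits_gen.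
  + by rewrite tensMl -tens_act_tens; apply: splitsM => //; apply: splits_act.
  + by rewrite tensVg; apply/splits_act/splitsV.
- by rewrite tensMr -tens_act_tens; apply: splitsM => //; apply: splits_act.
- by rewrite tensgV; apply/splits_act/splitsV.
Qed.

(** The recovered part of t has the boundary of t, so it is trivial, and t
    lies in the central part, on which the pairings are faithful. *)
Theorem tensor_free_ker t : bd t = 1 ->
  (forall p : 'I_n * 'I_n, p.1 <= p.2 -> pairing p t = 0%R) -> t = 1.
Proof.
have [s [z [r c ->]]] := splits_all t.
rewrite bdM (sym_span_bd c) mulg1 => s1.
have -> : s = 1 by rewrite -(r 1) s1 crossed1.
by rewrite mul1g; apply: sym_span_ker.
Qed.
End Kernel.

(** * A faithful representation of a free group by integral matrices *)

Section ReducedWords.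
Variable n : nat.
Implicit Types (w : word 'I_n) (l : 'I_n * bool).

Definition no_cancel l l' := ~~ ((l.1 == l'.1) && (l.2 == ~~ l'.2)).
Local Notation reduced := (sorted no_cancel).

Lemma reduced_class (g : free_group n) :
  exists2 w, reduced w & g = pres_class _ w.
Proof.
rewrite -(pres_reprK g).
elim: (repr g) => [|l w [v rv e]]; first by exists [::].
have {}e : pres_class (fun _ _ : word 'I_n => False) (l :: w) =
    pres_class _ (l :: v) by rewrite !pres_class_cons e.
case: v rv e => [|l' v] rv e; first by exists [:: l].
have [nc|/negPn/andP[/eqP l1 /eqP l2]] := boolP (no_cancel l l').
  by exists [:: l, l' & v] => //=; rewrite nc.
exists v; first exact: path_sorted rv.
rewrite e; apply/pres_classP; case: l l' {rv e} l1 l2 => [x b] [y c] /= -> ->.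
by have := PresCancel (fun _ _ => False) [::] v y (~~ c); rewrite negbK.
Qed.
End ReducedWords.

Section PingPong.
Local Open Scope ring_scope.
Variable R : comUnitRingType.

(** With s = 1, the conjugate of the lower triangular matrix with lower left
    entry 2 by the translation z -> z + c. These matrices form a one-parameter
    group in s that fixes the vector (c, 1). *)
Definition shear (c s : R) : 'M[R]_2 := \matrix_(i, j)
  if i == 0 then if j == 0 then 1 + 2 * s * c else - (2 * s * c ^+ 2)
  else if j == 0 then 2 * s else 1 - 2 * s * c.

Lemma shearD c s s' : shear c s *m shear c s' = shear c (s + s').
Proof.
apply/matrixP => i j; rewrite !mxE !big_ord_recl big_ord0 !mxE /=.
by case: (i == 0); case: (j == 0); ring.
Qed.

Lemma shear0 c : shear c 0 = 1%:M.
Proof.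
apply/matrixP => i j; rewrite !mxE.
by case: i => [[|[|?]] //=] ?; case: j => [[|[|?]] //=] ?; ring.
Qed.

Lemma shear_unit c s : shear c s \in unitmx.
Proof.
by have /mulmx1_unit[] : shear c s *m shear c (- s) = 1%:M
  by rewrite shearD subrr shear0.
Qed.

Definition shearGL c s : GL 2 R := MkGL (shear_unit c s).

Lemma shearGLV c s : ((shearGL c s)^-1)%g = shearGL c (- s).
Proof.
by apply: mulg1_eq; apply: val_inj; rewrite /= shearD subrr shear0.
Qed.

Variable n : nat.

Implicit Types (l : 'I_n * bool) (v : int * int) (w : word 'I_n).

(** Translations by even integers, so that the intervals of length 2 around
    the centers have disjoint interiors. *)
Definition center (i : 'I_n) : int := (2 * i)%N.
Definition bsign (b : bool) : int := (-1) ^+ b.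

(** The action of a letter on a column vector (p, q). In the coordinates y = p
    - c q and q it fixes y and adds a multiple of y to q. *)
Definition step (l : 'I_n * bool) (v : int * int) : int * int :=
  let c := center l.1 in let y := v.1 - c * v.2 in
  let q := v.2 + 2 * bsign l.2 * y in (y + c * q, q).

(** In terms of the slope z = p / q: z - c lies strictly between 0 and 1 for a
    generator, and strictly between -1 and 0 for an inverse. *)
Definition region (l : 'I_n * bool) (v : int * int) :=
  0 < bsign l.2 * (v.1 - center l.1 * v.2) * v.2 < v.2 ^+ 2.

Lemma step_far l v : v.2 ^+ 2 < (v.1 - center l.1 * v.2) ^+ 2 ->
  region l (step l v).
Proof.
rewrite /region /step /=; set y := v.1 - _; set q := v.2.
have -> u : y + center l.1 * u - center l.1 * u = y by ring.
by rewrite /bsign; case: l.2; rewrite ?expr0 ?expr1 => h; nia.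
Qed.

Lemma step_near l v : region l v -> region l (step l v).
Proof.
rewrite /region /step /=; set y := v.1 - _; set q := v.2.
have -> u : y + center l.1 * u - center l.1 * u = y by ring.
by rewrite /bsign; case: l.2; rewrite ?expr0 ?expr1 => h; nia.
Qed.

(** In terms of slopes: two centers are at distance at least 2, so a point
    within distance 1 of one of them is far from all the others. *)
Lemma region_far l l' v : l.1 != l'.1 -> region l' v ->
  v.2 ^+ 2 < (v.1 - center l.1 * v.2) ^+ 2.
Proof.
rewrite -val_eqE /region /center /=; move: (val l.1) (val l'.1) => i j ij.
case: v => p q /=; case/andP.
set y := p - _ * q => /= h1 h2.
have {h1 h2} [h1 h2] : - q ^+ 2 < y * q /\ y * q < q ^+ 2.
  by move: h1 h2; rewrite /bsign; case: l'.2; rewrite ?expr0 ?expr1; split; nia.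
(* In both cases compare u * q with q ^+ 2: the distance between the
   centers contributes at least 2 q ^+ 2, and y * q cancels less than q ^+
   2. *)
set u := p - _; have qq : 0 <= q ^+ 2 by apply: sqr_ge0.
have [h|h] : q ^+ 2 < u * q \/ u * q < - q ^+ 2.
  have -> : u * q = y * q + 2 * (j%:Z - i%:Z) * q ^+ 2 by rewrite /u /y; nia.
  have [ltij|ltji] : (i < j \/ j < i)%N by lia.
    by left; nia.
  by right; nia.
- have := sqr_ge0 (u - q); nia.
- have := sqr_ge0 (u + q); nia.
Qed.

Definition orbit_pt (w : word 'I_n) : int * int := foldr step (1, 0) w.

(** Ping-pong: the slope at infinity is far from every center, and a letter
    brings into its own region every point that is far from its center or
    already in that region. The only other case is excluded because the word
    is reduced. *)
Lemma orbit_region l w : sorted (@no_cancel n) (l :: w) ->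
  region l (orbit_pt (l :: w)).
Proof.
elim: w l => [|l' w ih] l; first by move=> _; apply: step_far; rewrite /=; lia.
case/andP=> nc /ih r; move: nc; rewrite /no_cancel negb_and.
have [e1 /=|ne1 _] := eqVneq l.1 l'.1; last exact/step_far/(region_far ne1).
move=> e2; apply: step_near; suff -> : l = l' by [].
by move: e1 e2; case: l l' {ih r} => [x b] [y c] /= -> ; case: b c => [] [].
Qed.

Lemma orbit_neq0 w : sorted (@no_cancel n) w -> w != [::] ->
  (orbit_pt w).2 != 0.
Proof.
case: w => [//|l w] /orbit_region + _; rewrite /region; apply: contraTneq => ->.
by rewrite expr0n /= mulr0 ltxx.
Qed.

Definition sanov_rep : free_group n -> GL 2 R :=
  free_lift (fun i => shearGL (center i)%:~R 1).
HB.instance Definition _ := UMagmaMorphism.on sanov_rep.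

Lemma sanov_letter l :
  letter_val (fun i => shearGL (center i)%:~R 1) l =
  shearGL (center l.1)%:~R (bsign l.2)%:~R.
Proof. by case: l => i []; rewrite /letter_val /= ?shearGLV // rmorphN. Qed.

Lemma sanov_orbit w :
  let M := val (sanov_rep (pres_class _ w)) in let v := orbit_pt w in
  M 0 0 = v.1%:~R /\ M 1 0 = v.2%:~R.
Proof.
rewrite /= /sanov_rep /free_lift pres_lift_class /word_val.
elim: w => [|l w [ih1 ih2]]; first by rewrite big_nil !mxE /=.
rewrite big_cons sanov_letter /= !mxE !big_ord_recl !big_ord0 !mxE /= !addr0.
have -> : lift ord0 ord0 = 1 :> 'I_2 by apply: val_inj.
rewrite ih1 ih2 /step /=; case: (orbit_pt w) => p q /=.
by split; rewrite !(rmorphD, rmorphM, rmorphB, rmorphN, rmorph1) /=; ring.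
Qed.

Hypothesis R0 : forall z : int, (z%:~R == 0 :> R) = (z == 0).

(** A nontrivial reduced word moves the slope at infinity, hence has a nonzero
    lower left entry. Stating faithfulness through this entry makes it
    insensitive to scalar factors. *)
Lemma sanov_lower_eq0 g : val (sanov_rep g) 1 0 = 0 -> g = 1%g.
Proof.
have [w rw ->] := reduced_class g; have [_ -> /eqP] := sanov_orbit w.
rewrite R0; apply: contraTeq => wn; apply: orbit_neq0 rw _.
by apply: contraNneq wn => ->.
Qed.
End PingPong.

(** * Laurent monomials *)

Section LaurentMonomials.
Local Open Scope ring_scope.
Variable m : nat.
Local Notation K := {fraction {mpoly int[m]}}.
Implicit Types a b : {ffun 'I_m -> int}.

Lemma laurent_intr_eq0 (z : int) : (z%:~R == 0 :> laurent m) = (z == 0).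
Proof.
rewrite -(inj_eq val_inj) rmorph_int rmorph0.
rewrite -(rmorph_int (@tofrac {mpoly int[m]})) tofrac_eq0.
by rewrite -(rmorph_int (@mpolyC m int)) mpolyC_eq0 intz.
Qed.

Fact laurent_monomial_is_laurent a : laurent_monomial a \in @is_laurent m.
Proof.
by apply/asboolP; exists [:: (1, a)]; rewrite /laurent_sum big_seq1 mul1r.
Qed.

Definition monomial a : laurent m := Laurent (laurent_monomial_is_laurent a).

Lemma monomialD a b : monomial (a + b) = monomial a * monomial b.
Proof. by apply: val_inj; rewrite /= laurent_monomialM. Qed.

Lemma monomial0 : monomial 0 = 1.
Proof.
by apply: val_inj; rewrite /= /laurent_monomial big1 // => i _; rewrite ffunE.
Qed.

Lemma monomial_unit a : monomial a \is a GRing.unit.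
Proof.
by apply/unitrPr; exists (monomial (- a)); rewrite -monomialD subrr monomial0.
Qed.

(** Splitting the exponents into positive and negative parts turns the
    equation into an equality of two monomials of the polynomial ring. *)
Lemma monomial_eq1 a : monomial a = 1 -> forall k, a k = 0.
Proof.
move=> /(congr1 val); rewrite rmorph1 /= => a1.
pose pos (z : int) := `|Num.max z 0|%N.
pose neg (z : int) := `|Num.max (- z) 0|%N.
pose X (e : int -> nat) : {mpoly int[m]} := 'X_[ [multinom e (a i) | i < m] ].
have XE e : tofrac (X e) =
    \prod_(i < m) (tofrac ('X_i : {mpoly int[m]})) ^+ e (a i).
  rewrite /X mpolyXE_id rmorph_prod; apply: eq_bigr => i _.
  by rewrite rmorphXn /= mnmE.
have : X pos = X neg.
  apply/eqP; rewrite -tofrac_eq !XE; apply/eqP.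
  rewrite -[RHS]mul1r -[X in _ = X * _]a1 /laurent_monomial -big_split /=.
  apply: eq_bigr => i _; rewrite !exprnP -expfzDr; last first.
    rewrite tofrac_eq0; apply/eqP => /(congr1 (mcoeff U_(i))) /eqP.
    by rewrite mcoeffX mcoeff0 eqxx.
  by congr (_ ^ _); rewrite /pos /neg; lia.
move=> /(congr1 (mcoeff [multinom pos (a i) | i < m])).
rewrite !mcoeffX eqxx; case: eqP => // e _ k.
move/mnmP: e => /(_ k); rewrite !mnmE /pos /neg; lia.
Qed.
End LaurentMonomials.

(** * The representation *)

Section Representation.
Variable n : nat.
Local Notation m := ((n * (n + 1)) %/ 2)%N.
Local Notation F := (free_group n).
Local Notation T := (tensor_square F).
Local Notation R := (laurent m).

Definition le_pairs : {set 'I_n * 'I_n} := [set p : 'I_n * 'I_n | p.1 <= p.2].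

Lemma card_le_pairs : m = #|le_pairs|.
Proof.
have -> : #|le_pairs| = \sum_(j < n) \sum_(i < n | i <= j) 1.
  by rewrite -sum1dep_card [RHS](exchange_big_dep xpredT) //= pair_big_dep.
rewrite addn1 mulnC divn2 -(bin2 n.+1) -triangular_sum.
rewrite big_nat_recl // add0n big_mkord; apply: eq_bigr => j _.
have <- := big_ord_widen n (fun=> 1%N) (ltn_ord j).
by rewrite sum1_card card_ord.
Qed.

Definition nth_pair (k : 'I_m) : 'I_n * 'I_n :=
  enum_val (cast_ord card_le_pairs k).

Lemma nth_pair_onto (p : 'I_n * 'I_n) : p.1 <= p.2 -> exists k, nth_pair k = p.
Proof.
move=> p12; have pP : p \in le_pairs by rewrite inE.
exists (cast_ord (esym card_le_pairs) (enum_rank_in pP p)).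
by rewrite /nth_pair cast_ordKV enum_rankK_in.
Qed.

Definition pairings (t : T) : {ffun 'I_m -> int} :=
  [ffun k => pairing (nth_pair k) t].

Lemma pairingsM s t : pairings (s * t) = (pairings s + pairings t)%R.
Proof. by apply/ffunP => k; rewrite !ffunE pairingM. Qed.

Fact scalar_monomial_unit a : ((monomial a)%:M : 'M[R]_2)%R \in unitmx.
Proof. by rewrite unitmxE det_scalar unitrX ?monomial_unit. Qed.

Definition tensor_rep (t : T) : GL 2 R :=
  MkGL (scalar_monomial_unit (pairings t)) * sanov_rep R (bd t).

Lemma val_tensor_rep t : val (tensor_rep t) =
  (monomial (pairings t) *: val (sanov_rep R (bd t)))%R.
Proof. exact: mul_scalar_mx. Qed.

Fact tensor_rep_morph : {morph tensor_rep : s t / s * t}.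
Proof.
move=> s t; apply: val_inj.
rewrite -[RHS]/(val (tensor_rep s) *m val (tensor_rep t))%R !val_tensor_rep.
by rewrite -scalemxAl -scalemxAr scalerA -monomialD -pairingsM bdM gmulfM.
Qed.

Fact tensor_rep_div : {morph tensor_rep : s t / s * t^-1}.
Proof.
by move=> s t; apply: (canRL (mulgK _)); rewrite -tensor_rep_morph mulgVK.
Qed.

HB.instance Definition _ :=
  isGroupMorphism.Build T (GL 2 R) tensor_rep tensor_rep_div.

(** The lower left entry shows that bd t is trivial; the matrix is then the
    scalar matrix of a monomial, whose exponents are the pairings of t. *)
Lemma tensor_rep_inj : injective tensor_rep.
Proof.
apply: gmulf_inj => t /(congr1 val); rewrite val_tensor_rep => e.
have t1 : bd t = 1.
  apply: (@sanov_lower_eq0 R); first exact: laurent_intr_eq0.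
  apply: (mulrI (monomial_unit (pairings t))); rewrite mulr0.
  by have /matrixP/(_ 1 0)%R := e; rewrite !mxE.
apply: tensor_free_ker => // p /nth_pair_onto[k <-].
have /matrixP/(_ 0 0)%R := e; rewrite t1 gmulf1 !mxE /= mulr1.
by move=> /monomial_eq1/(_ k); rewrite ffunE.
Qed.
End Representation.

Theorem corollary6p2 (n : nat) :
  exists rho : {multiplicative tensor_square (free_group n)
                  -> GL 2 (laurent ((n * (n + 1)) %/ 2))},
    injective rho.
Proof. by exists (@tensor_rep n); apply: tensor_rep_inj. Qed.
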